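(* Let $k$ be an infinite field and let $A$, $\tilde A$ be Gorenstein (local commutative associative unital) $k$-algebras of finite vector space dimension greater than $1$ and socle degree $\nu$, where either $\mathrm{char}(k)=0$ or $\mathrm{char}(k)>\nu$. Let $\mathfrak m$, $\tilde{\mathfrak m}$ be the maximal ideals of $A$, $\tilde A$, let $\pi$, $\tilde\pi$ be admissible projections on $A$, $\tilde A$, respectively, and let $S_\pi\subset\mathfrak m$, $S_{\tilde\pi}\subset\tilde{\mathfrak m}$ be the associated hypersurfaces. Then $A$ and $\tilde A$ are isomorphic (as $k$-algebras) if and only if the hypersurfaces $S_\pi$ and $S_{\tilde\pi}$ are affinely equivalent. Moreover, if $\mathcal A:\mathfrak m\to\tilde{\mathfrak m}$ is a linear isomorphism such that $\mathcal A(S_\pi)=S_{\tilde\pi}$, then $\mathcal A$ is an algebra isomorphism (that is, $\mathcal A(xy)=\mathcal A(x)\mathcal A(y)$ for all $x,y\in\mathfrak m$).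
   Context: All algebras are Artinian local commutative associative algebras over a field $k$ with identity element $\mathbf 1$. For such an algebra $A$ with maximal ideal $\mathfrak m$, the socle is $\mathrm{Soc}(A)=\{x\in A: x\,\mathfrak m=0\}$, and $A$ is Gorenstein if and only if $\dim_k\mathrm{Soc}(A)=1$. The socle degree $\nu$ of $A$ is the largest integer $\mu$ with $\mathfrak m^\mu\neq 0$; when $\dim_kA>1$ one has $\nu\ge1$ and $\mathrm{Soc}(A)=\mathfrak m^\nu$. Assume $\dim_k A>1$ and either $\mathrm{char}(k)=0$ or $\mathrm{char}(k)>\nu$. The exponential map $\exp:\mathfrak m\to\mathbf 1+\mathfrak m$ is $\exp(x)=\sum_{m=0}^{\nu}\frac1{m!}x^m$, with $x^0=\mathbf 1$. An admissible projection on $A$ is a $k$-linear projection $\pi:A\to A$ (i.e. $\pi^2=\pi$) with range $\mathrm{Soc}(A)$ and $\pi(\mathbf 1)=0$. Given an admissible projection $\pi$, set $\mathcal K=\ker\pi\cap\mathfrak m$, so that $\mathfrak m=\mathcal K\oplus\mathrm{Soc}(A)$, and define the polynomial map $$P_\pi:\mathcal K\to\mathrm{Soc}(A),\qquad P_\pi(x)=\pi(\exp(x))=\pi\Bigl(\sum_{m=2}^{\nu}\tfrac1{m!}x^m\Bigr).$$ The hypersurface $S_\pi\subset\mathfrak m$ is the graph of $P_\pi$: $S_\pi=\{x+P_\pi(x):x\in\mathcal K\}\subset\mathcal K\oplus\mathrm{Soc}(A)=\mathfrak m$. The same definitions apply to $\tilde A$, $\tilde{\mathfrak m}$, $\tilde\pi$.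 $S_\pi$ and $S_{\tilde\pi}$ are affinely equivalent if there is a bijective affine map $\mathcal A:\mathfrak m\to\tilde{\mathfrak m}$ with $\mathcal A(S_\pi)=S_{\tilde\pi}$. *)

(* Defs.v *)
From HB Require Import structures.
From mathcomp Require Import all_boot all_algebra falgebra.
From mathcomp Require Import boolp classical_sets functions cardinality.

Set Implicit Arguments.
Unset Strict Implicit.
Unset Printing Implicit Defensive.

Import GRing.Theory.
Local Open Scope ring_scope.
Local Open Scope classical_set_scope.

#[short(type="comFalgType")]
HB.structure Definition ComFalgebra (k : fieldType) :=
  { A of Falgebra k A & GRing.ComNzRing A }.

Section Algebra.
Variables (k : fieldType) (A : comFalgType k).
Implicit Types (I M : {vspace A}) (x y : A).

(* Every ideal of a unital k-algebra is a k-subspace, so quantifying over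
   {vspace A} misses no ideal. *)
Definition is_ideal I : bool := ({: A} * I <= I)%VS.

Definition is_maximal_ideal M : Prop :=
  [/\ is_ideal M, M != fullv
    & forall I, is_ideal I -> (M <= I)%VS -> I = M \/ I = fullv].

Definition local_with_maximal_ideal M : Prop :=
  is_maximal_ideal M /\ (forall M', is_maximal_ideal M' -> M' = M).

Definition socle M : {vspace A} := (\bigcap_(y <- vbasis M) lker (amulr y))%VS.

Lemma socleP M x :
  reflect (forall y, y \in M -> x * y = 0) (x \in socle M).
Proof.
have socE : (x \in socle M) = all (fun y => x * y == 0) (vbasis M).
  rewrite /socle; elim: (tval (vbasis M)) => [|y s IHs] /=.
    by rewrite big_nil memvf.
  by rewrite big_cons memv_cap IHs memv_ker lfunE.
rewrite socE; apply: (iffP allP) => [xM0 y /coord_vbasis -> | xM0 y My].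
  rewrite mulr_sumr big1 // => i _; rewrite -scalerAr (eqP (xM0 _ _)) ?scaler0//.
  by rewrite mem_nth ?size_tuple.
by rewrite xM0 ?vbasis_mem.
Qed.

Definition gorenstein M : Prop :=
  local_with_maximal_ideal M /\ \dim (socle M) = 1%N.

Definition has_socle_degree M (nu : nat) : Prop :=
  (M ^+ nu)%VS != 0%VS /\
  (forall mu : nat, (M ^+ mu)%VS != 0%VS -> (mu <= nu)%N).

(* The exponential series truncated at degree nu. *)
Definition texp (nu : nat) x : A := \sum_(0 <= i < nu.+1) (i`!%:R)^-1 *: x ^+ i.

Definition admissible_projection M (pi : 'End(A)) : Prop :=
  [/\ (pi \o pi)%VF = pi, limg pi = socle M & pi 1 = 0].

Definition calK M (pi : 'End(A)) : {vspace A} := (lker pi :&: M)%VS.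

Definition Ppi (nu : nat) (pi : 'End(A)) x : A := pi (texp nu x).

Definition hypersurface M (nu : nat) (pi : 'End(A)) : set (subvs_of M) :=
  [set z | exists2 x, x \in calK M pi & vsval z = x + Ppi nu pi x].

(* The projection vsproj only casts the product back into M when M is an
   ideal, see vsval_idealmul. *)
Definition idealmul M (u v : subvs_of M) : subvs_of M :=
  vsproj M (vsval u * vsval v).

Lemma vsval_idealmul M (u v : subvs_of M) :
  is_ideal M -> vsval (idealmul u v) = vsval u * vsval v.
Proof. by move=> /prodvP idM; rewrite vsprojK // idM ?memvf ?subvsP. Qed.

End Algebra.

Arguments hypersurface {k A} M nu pi _.

Definition alg_isomorphic (k : fieldType) (A B : comFalgType k) : Prop :=
  exists f : {lrmorphism A -> B}, bijective f.

Definition is_affine (k : fieldType) (U V : vectType k) (F : U -> V) : Prop :=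
  exists (L : 'Hom(U, V)) (b : V), forall u, F u = L u + b.

Definition affinely_equivalent (k : fieldType) (U V : vectType k)
    (S : set U) (T : set V) : Prop :=
  exists F : U -> V, [/\ bijective F, is_affine F & F @` S = T].

(* Main.v *)
(* Write pi = w(.) s with s spanning the socle; the form w(xy) is nondegenerate.
   The graph S_pi is the image under the reflection id - 2 pi of the zero locus
   of w o exp on the maximal ideal.  Any other functional is w(a .) for some a,
   up to scale a = exp(x), and w(exp(x) exp(y)) = w(exp(x + y)), so changing the
   projection translates that locus; the same identity turns an affine
   equivalence into a linear one.
   If L is linear and matches the zero loci of h = sum_i c_i w(y^i) and
   h' = sum_i c_i v(y^i), then on every line h' o L vanishes modulo h, because h
   is affine with nonzero slope in the socle direction: moving a point y of the
   line by - h(y)/c_1 along s lands in the locus.  By symmetry h and h' o L are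
   associate polynomials on every line, hence h' o L = a h with a constant.
   Comparing the terms of degrees 1, 2, 3 and polarizing gives
   v(L(xy) L(z)) = a w(xyz) = v(L(x) L(y) L(z)), and L is multiplicative by
   nondegeneracy. *)
Require Import Defs.
From HB Require Import structures.
From mathcomp Require Import all_boot all_algebra falgebra.
From mathcomp Require Import boolp classical_sets functions cardinality.
From mathcomp Require Import ring.

Set Implicit Arguments.
Unset Strict Implicit.
Unset Printing Implicit Defensive.

Import GRing.Theory.
Local Open Scope ring_scope.
Local Open Scope classical_set_scope.

(* [s] spans the socle and [w] is the coordinate of an admissible projection
   along [s]; [w (a * s)] is then the residue of [a] modulo [M]. *)
Record gorenstein_functional (k : fieldType) (A : comFalgType k)
    (M : {vspace A}) (nu : nat) (s : A) (w : {scalar A}) : Prop := {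
  gf_ideal : is_ideal M;
  gf_nil : (M ^+ nu.+1)%VS = 0%VS;
  gf_memS : s \in M;
  gf_mulMs : forall x, x \in M -> x * s = 0;
  gf_socle : forall x, (forall y, y \in M -> x * y = 0) -> x = w x *: s;
  gf_ws : w s = 1;
  gf_w1 : w 1 = 0;
  gf_residue : forall a, a - w (a * s) *: 1 \in M }.

(** * Powers of an ideal *)

Section PowersOfSubspace.
Variables (k : fieldType) (A : comFalgType k) (M : {vspace A}).
Implicit Types (x y : A) (i j n : nat).

Lemma mem_expvS i x y : x \in (M ^+ i)%VS -> y \in M -> x * y \in (M ^+ i.+1)%VS.
Proof. by move=> xM yM; rewrite expvSr memv_mul. Qed.

Lemma mem_expvX i x : x \in M -> x ^+ i \in (M ^+ i)%VS.
Proof.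
move=> xM; elim: i => [|i IHi]; first by rewrite expr0 expv0 memv_line.
by rewrite exprSr mem_expvS.
Qed.

Lemma mem_expvM i j x y :
  x \in (M ^+ i)%VS -> y \in (M ^+ j)%VS -> x * y \in (M ^+ (i + j))%VS.
Proof. by move=> xM yM; rewrite expvD memv_mul. Qed.

Hypothesis idM : is_ideal M.

Lemma mem_idealMl a x : x \in M -> a * x \in M.
Proof. by move=> xM; move/prodvP: idM; apply; rewrite ?memvf. Qed.

Lemma mem_idealMr a x : x \in M -> x * a \in M.
Proof. by rewrite mulrC; apply: mem_idealMl. Qed.

Lemma mem_idealX x n : x \in M -> (0 < n)%N -> x ^+ n \in M.
Proof. by case: n => // n xM _; rewrite exprS mem_idealMr. Qed.

(** Exponents start at 1 because [(M ^+ 0)%VS] is the line spanned by [1], not the whole algebra. *)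
Lemma expvS_sub n : (M ^+ n.+2 <= M ^+ n.+1)%VS.
Proof.
elim: n => [|n IHn]; last by rewrite expvSl [X in (_ <= X)%VS]expvSl prodvS.
rewrite expvSl expv1; apply/prodvP => x y xM yM; exact: mem_idealMl.
Qed.

Lemma expv_anti i j : (i <= j)%N -> (M ^+ j.+1 <= M ^+ i.+1)%VS.
Proof.
move=> ij; rewrite -(subnKC ij); elim: (_ - _)%N => [|n IHn]; first by rewrite addn0.
by rewrite addnS; apply: subv_trans (expvS_sub _) IHn.
Qed.

End PowersOfSubspace.

(** * The truncated exponential on a nilpotent ideal *)

Section Exponential.
Variables (k : fieldType) (A : comFalgType k) (M : {vspace A}) (nu : nat).
Hypothesis idM : is_ideal M.
Hypothesis nilM : (M ^+ nu.+1)%VS = 0%VS.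
Implicit Types (x y u v : A).

Lemma expv_eq0 j x : (nu < j)%N -> x \in (M ^+ j)%VS -> x = 0.
Proof.
case: j => // j lt_nu xM; have := subvP (expv_anti idM (lt_nu : nu <= j)%N) _ xM.
by rewrite nilM memv0 => /eqP.
Qed.

(** Taking a factor [x] out of a term of degree at least 2 leaves an element of [M]. This
    first-order form drives the approximation in [texp_surj]. *)
Lemma texp_expand x : (0 < nu)%N -> x \in M ->
  exists2 y, y \in M & texp nu x = 1 + x * (1 + y).
Proof.
case: nu => // n _ xM.
exists (\sum_(0 <= i < n) (i.+2`!%:R)^-1 *: x ^+ i.+1).
  by rewrite rpred_sum // => i _; rewrite rpredZ // mem_idealX.
rewrite /texp big_nat_recl // big_nat_recl // !invr1 !scale1r expr0 expr1.
rewrite mulrDr mulr1 mulr_sumr; congr (_ + (_ + _)).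
by apply: eq_bigr => i _; rewrite -scalerAr -exprS.
Qed.

Lemma texp_sub1 x : (0 < nu)%N -> x \in M -> texp nu x - 1 \in M.
Proof.
move=> nu0 xM; have [y yM ->] := texp_expand nu0 xM.
by rewrite addrC addKr mem_idealMr.
Qed.

Lemma texp0 : texp nu (0 : A) = 1.
Proof.
rewrite /texp big_nat_recl // expr0 invr1 scale1r big1_seq ?addr0 // => i _.
by rewrite exprS mul0r scaler0.
Qed.

Hypothesis fact_unit : forall i, (i <= nu)%N -> i`!%:R != 0 :> k.

(** An auxiliary variable separates degrees: each exponential is the value at 1 of a polynomial. Up
    to degree [nu] the coefficients agree by the binomial theorem; beyond it, those of the product
    lie in vanishing powers of [M]. *)
Lemma texpD u v : u \in M -> v \in M ->
  texp nu (u + v) = texp nu u * texp nu v.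
Proof.
move=> uM vM.
pose P (x : A) : {poly A} := \poly_(i < nu.+1) ((i`!%:R)^-1 *: x ^+ i).
have texpE x : texp nu x = (P x).[1].
  rewrite (horner_coef_wide _ (size_poly _ _)) /texp big_mkord.
  by apply: eq_bigr => i _; rewrite coef_poly ltn_ord expr1n mulr1.
rewrite !texpE -hornerM; congr (_.[1]); apply/polyP => n.
rewrite coefM coef_poly; case: ltnP => [le_n|lt_n]; last first.
  rewrite big1 // => [[i /= lei] _].
  rewrite !coef_poly; case: ltnP => _; last by rewrite mul0r.
  case: ltnP => _; last by rewrite mulr0.
  rewrite -scalerAl -scalerAr.
  rewrite (@expv_eq0 n (u ^+ i * v ^+ (n - i))) ?scaler0 //.
  by rewrite -{2}(@subnKC i n) // mem_expvM ?mem_expvX.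
rewrite addrC exprDn scaler_sumr; apply: eq_bigr => [[i /= lei] _].
rewrite !coef_poly (leq_trans lei le_n) (leq_ltn_trans (leq_subr _ _) le_n).
rewrite -scalerAl -scalerAr !scalerA.
rewrite -[_ *+ 'C(n, i)]scaler_nat scalerA [v ^+ _ * _]mulrC; congr (_ *: _).
have -> : n`!%:R = 'C(n, i)%:R * (i`!%:R * (n - i)`!%:R) :> k.
  by rewrite -!natrM bin_fact.
have Cn : 'C(n, i)%:R != 0 :> k.
  have := fact_unit le_n; rewrite -(@bin_fact n i) // natrM mulf_eq0.
  by case/norP.
by rewrite invfM mulrAC mulVf // mul1r invfM.
Qed.

(** Successive approximation: adding the remainder [r] of [a] to [v] pushes the new remainder into
    the next power of [M], until it reaches the zero power [nu.+1]. *)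
Lemma texp_surj a : (0 < nu)%N -> a - 1 \in M ->
  exists2 v, v \in M & texp nu v = a.
Proof.
move=> nu0 a1.
suff /(_ nu) [v vM av] : forall j, exists2 v, v \in M & a - texp nu v \in (M ^+ j.+1)%VS.
  by exists v => //; apply/eqP; rewrite eq_sym -subr_eq0 (expv_eq0 _ av).
elim=> [|j [v vM rM]]; first by exists 0; rewrite ?mem0v // texp0 expv1.
set r := a - _ in rM.
have rM1 : r \in M by rewrite -[M]expv1; apply: (subvP (expv_anti idM (leq0n j))).
exists (v + r); first by rewrite rpredD.
rewrite texpD //.
have [y yM ->] := texp_expand nu0 rM1.
(* The second factor lies in [M] because [texp nu v] is 1 modulo [M]. *)
have -> : a - texp nu v * (1 + r * (1 + y)) =
   r * (- (texp nu v - 1) - texp nu v * y) by rewrite /r; ring.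
apply: mem_expvS => //.
by rewrite rpredB ?rpredN ?texp_sub1 ?mem_idealMl.
Qed.

End Exponential.

(** * Duality for the form [w (x * y)] *)

Section FunctionalTheory.
Variables (k : fieldType) (A : comFalgType k) (M : {vspace A}) (nu : nat).
Variables (s : A) (w : {scalar A}).
Hypothesis gf : gorenstein_functional M nu s w.
Implicit Types x y a : A.

Let idM := gf_ideal gf.

Lemma gf_s_neq0 : s != 0.
Proof. by apply/eqP => s0; have /eqP := gf_ws gf; rewrite s0 linear0 eq_sym oner_eq0. Qed.

Lemma gf_nu_gt0 : (0 < nu)%N.
Proof.
case: (posnP nu) (gf_nil gf) => // ->; rewrite expv1 => M0.
by have := gf_memS gf; rewrite M0 memv0 (negPf gf_s_neq0).
Qed.

Lemma gf_mul_s a : a * s = w (a * s) *: s.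
Proof. by apply: (gf_socle gf) => y yM; rewrite -mulrA [s * y]mulrC (gf_mulMs gf) ?mulr0. Qed.

Lemma gf_mul2_eq0 x y : (nu <= 1)%N -> x \in M -> y \in M -> x * y = 0.
Proof.
move=> le1 xM yM; apply: (@expv_eq0 _ _ _ _ idM (gf_nil gf) 2%N _ le1).
by rewrite !expvSr expv0 prod1v memv_mul.
Qed.

Lemma gf_mul3_eq0 x y z :
  (nu <= 2)%N -> x \in M -> y \in M -> z \in M -> x * y * z = 0.
Proof.
move=> le2 xM yM zM; apply: (@expv_eq0 _ _ _ _ idM (gf_nil gf) 3%N _ le2).
by rewrite !expvSr expv0 prod1v !memv_mul.
Qed.

(** Induction on a power of [M] killed by [x]. If [x] kills the power [j.+1], then for [y] in [M]
    the product [x * y] kills the power [j], hence is 0; so [x] is in the socle, where [w] is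
    injective. *)
Lemma gf_nondegenerate x : (forall y, w (x * y) = 0) -> x = 0.
Proof.
suff: forall j x, (forall y, y \in (M ^+ j)%VS -> x * y = 0) ->
    (forall y, w (x * y) = 0) -> x = 0.
  by move/(_ nu.+1 x); apply=> y; rewrite (gf_nil gf) memv0 => /eqP->; rewrite mulr0.
elim=> [|j IHj] {}x xM xw; first by rewrite -[x]mulr1 xM // expv0 memv_line.
rewrite (gf_socle gf (x := x)) => [|y yM]; first by rewrite -[x]mulr1 xw scale0r.
by apply: IHj => [z zM|z]; rewrite -mulrA // xM // mulrC mem_expvS.
Qed.

(** By nondegeneracy the map sending [a] to [w (a * _)] is injective, hence onto the dual by
    equality of dimensions. Functionals are encoded as rows of values on a basis. *)
Lemma gf_representable (phi : {scalar A}) : exists a, forall x, phi x = w (a * x).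
Proof.
pose e := vbasis {:A}.
pose T a : 'rV[k]_(\dim {:A}) := \row_i w (a * e`_i).
have linT : linear T.
  by move=> c a b; apply/rowP => i; rewrite !mxE mulrDl -scalerAl linearP.
pose lT := GRing.isLinear.Build _ _ _ _ T linT.
pose T' := linfun (HB.pack_for {linear A -> 'rV[k]_(\dim {:A})} T lT).
have coordE x : x = \sum_i coord e i x *: e`_i by apply: coord_vbasis; rewrite memvf.
have kT : lker T' = 0%VS.
  apply/eqP; rewrite -subv0; apply/subvP => a; rewrite memv_ker memv0 lfunE /= => /eqP Ta0.
  apply/eqP/gf_nondegenerate => y; rewrite (coordE y) mulr_sumr linear_sum big1 // => i _.
  by have /rowP/(_ i) := Ta0; rewrite !mxE -scalerAr linearZ /= => ->; rewrite mulr0.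
have fT : limg T' = fullv.
  apply/eqP; rewrite eqEdim subvf /=.
  have := limg_ker_dim T' fullv; rewrite kT capv0 dimv0 add0n => ->.
  by rewrite [X in (X <= _)%N]dimvf dim_matrix mul1r.
have : (\row_i phi e`_i : 'rV[k]_(\dim {:A})) \in limg T' by rewrite fT memvf.
case/memv_imgP => a _; rewrite lfunE /= => /rowP Ta; exists a => x.
rewrite (coordE x) mulr_sumr !linear_sum; apply: eq_bigr => i _.
by rewrite -scalerAr !linearZ; have := Ta i; rewrite !mxE => ->.
Qed.

End FunctionalTheory.

(** * Power series in a functional, restricted to polynomial curves *)

Lemma infinite_field_poly_eq0 (k : fieldType) (p : {poly k}) :
  infinite_set [set: k] -> (forall t, p.[t] = 0) -> p = 0.
Proof.
move=> kinf p0; apply/eqP/negPn/negP => pn0.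
have [B _ szB] := infinite_set_fset (size p) kinf.
suff : (size (finmap.enum_fset B) < size p)%N by rewrite ltnNge szB.
apply: max_poly_roots => //; last exact: finmap.fset_uniq.
by apply/allP => t _; apply/eqP/p0.
Qed.

Section FunctionalSeries.
Variables (k : fieldType) (A : comFalgType k) (w : {scalar A}).
Variables (c : nat -> k) (nu : nat).
Implicit Types (P Q : {poly A}) (p : {poly k}) (y : A).

Definition series y : k := \sum_(i < nu.+1) c i * w (y ^+ i).

(** Applying [w] coefficientwise passes from [A] to polynomials over the field [k], where
    divisibility and root counting are available. *)
Definition wpoly P : {poly k} := \poly_(i < size P) w P`_i.

Definition series_poly P : {poly k} := \sum_(i < nu.+1) c i *: wpoly (P ^+ i).

Lemma coef_wpoly P i : (wpoly P)`_i = w P`_i.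
Proof.
by rewrite coef_poly; case: ltnP => // lePi; rewrite nth_default // linear0.
Qed.

Lemma wpolyB : {morph wpoly : P Q / P - Q}.
Proof. by move=> P Q; apply/polyP => i; rewrite coefB !coef_wpoly coefB linearB. Qed.

Lemma wpolyMl p Q : wpoly (map_poly (in_alg A) p * Q) = p * wpoly Q.
Proof.
apply/polyP => n; rewrite coef_wpoly !coefM linear_sum; apply: eq_bigr => i _.
by rewrite coef_map mulr_algl linearZ coef_wpoly.
Qed.

Lemma horner_wpoly P t : (wpoly P).[t] = w P.[in_alg A t].
Proof.
rewrite horner_poly [P.[_]]horner_coef linear_sum; apply: eq_bigr => i _.
by rewrite -rmorphXn mulr_algr linearZ mulrC.
Qed.

Lemma horner_series_poly P t : (series_poly P).[t] = series P.[in_alg A t].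
Proof.
rewrite horner_sum; apply: eq_bigr => i _.
by rewrite hornerZ horner_wpoly horner_exp.
Qed.

(** Substituting a polynomial congruent modulo [p] changes every power by a multiple of [p], and
    [wpoly] is linear over polynomials with coefficients in [k]. *)
Lemma dvdp_series_polyB p P Q :
  p %| series_poly (P + map_poly (in_alg A) p * Q) - series_poly P.
Proof.
rewrite -sumrB; elim/big_ind: _ => [||i _]; [exact: dvdp0 | by move=> *; apply: dvdp_add |].
by rewrite -scalerBr -wpolyB subrXX addrC addKr -mulrA wpolyMl -mul_polyC dvdp_mull ?dvdp_mulr.
Qed.

Lemma coef_series_polyX y j : (j <= nu)%N ->
  (series_poly (y%:P * 'X))`_j = c j * w (y ^+ j).
Proof.
move=> lej; rewrite coef_sum (bigD1 (Ordinal (lej : (j < nu.+1)%N))) //= big1 => [|i ij].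
  by rewrite coefZ coef_wpoly exprMn -rmorphXn coefCM coefXn eqxx mulr1 addr0.
rewrite coefZ coef_wpoly exprMn -rmorphXn coefCM coefXn eq_sym.
by rewrite -(inj_eq val_inj) /= in ij; rewrite (negPf ij) mulr0 linear0 mulr0.
Qed.

End FunctionalSeries.

(** * Divisibility on lines from an inclusion of zero loci *)

Section LinearEquivalence.
Variables (k : fieldType) (A B : comFalgType k) (nu : nat).
Variables (M : {vspace A}) (s : A) (w : {scalar A}).
Variables (N : {vspace B}) (v : {scalar B}).
Hypothesis gfA : gorenstein_functional M nu s w.
Variable c : nat -> k.
Hypothesis c_neq0 : forall i, (0 < i <= nu)%N -> c i != 0.
Hypothesis kinf : infinite_set [set: k].

(** Since [s] kills [M], which contains [s], powers of exponent at least 2 do not see the shift;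
    only the linear term does. *)
Lemma series_translate_socle x e : x \in M ->
  series w c nu (x + e *: s) = series w c nu x + c 1%N * e.
Proof.
move=> xM; have := gf_nu_gt0 gfA; rewrite /series; case: nu => // n _.
rewrite !big_ord_recl /= !expr0 !expr1 linearD linearZ /= (gf_ws gfA) mulr1.
rewrite mulrDr -!addrA; congr (_ + (_ + _)); rewrite addrC; congr (_ + _).
apply: eq_bigr => i _; rewrite /bump /= !add1n; congr (_ * w _).
have sx : s * x = 0 by rewrite mulrC (gf_mulMs gfA).
have ss : s * s = 0 by rewrite (gf_mulMs gfA) ?(gf_memS gfA).
have xs : x * s = 0 by rewrite (gf_mulMs gfA).
elim: (i : nat) => [|j IHj].
  by rewrite !expr2 mulrDl !mulrDr -!scalerAr -!scalerAl sx xs ss !scaler0 !addr0.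
rewrite exprS IHj [RHS]exprS mulrDl -scalerAl [x ^+ _]exprS [s * _]mulrA sx.
by rewrite mul0r scaler0 addr0.
Qed.

Definition line_poly (C : comFalgType k) (x y : C) : {poly C} := x%:P + y%:P * 'X.

Lemma horner_line_poly (C : comFalgType k) (x y : C) e :
  (line_poly x y).[in_alg C e] = x + e *: y.
Proof. by rewrite !hornerE /= mulr_algr. Qed.

Lemma dvdp_series_line (L : 'Hom(subvs_of M, subvs_of N)) :
  (forall x, series w c nu (vsval x) = 0 -> series v c nu (vsval (L x)) = 0) ->
  forall x y, series_poly w c nu (line_poly (vsval x) (vsval y)) %|
    series_poly v c nu (line_poly (vsval (L x)) (vsval (L y))).
Proof.
move=> zeroL x y; set p := series_poly w _ _ _; set Y := line_poly (vsval (L x)) _.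
pose s' : subvs_of M := vsproj M s.
have s'E : vsval s' = s by rewrite vsprojK ?(gf_memS gfA).
have c1 : c 1%N != 0 by rewrite c_neq0 ?(gf_nu_gt0 gfA).
(* [Z] is the image under [L] of the line, corrected along the socle so that its points come from
   the zero locus. It differs from [Y] by a multiple of [p], so its vanishing series gives the
   divisibility. *)
pose Q : {poly B} := ((c 1%N)^-1 *: vsval (L s'))%:P.
pose Z := Y - map_poly (in_alg B) p * Q.
suff Z0 : series_poly v c nu Z = 0.
  by rewrite -[X in _ %| X]subr0 -Z0 -(subrK (map_poly (in_alg B) p * Q) Y) dvdp_series_polyB.
apply: infinite_field_poly_eq0 => // e; rewrite horner_series_poly.
(* The point of the line at parameter [e], moved along [s'] by the amount that cancels its series
   value [p.[e]]. *)
pose z := x + e *: y - ((c 1%N)^-1 * p.[e]) *: s'.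
have lin3 (U V : lmodType k) (f : {linear U -> V}) u1 u2 u3 (a b : k) :
    f (u1 + a *: u2 - b *: u3) = f u1 + a *: f u2 - b *: f u3.
  by rewrite linearB linearD !linearZ.
have -> : Z.[in_alg B e] = vsval (L z).
  rewrite hornerD hornerN hornerM hornerC horner_line_poly horner_map /z.
  by rewrite (lin3 _ _ L) (lin3 _ _ vsval) /= mulr_algl scalerA [p.[e] * _]mulrC.
apply: zeroL; rewrite /z (lin3 _ _ vsval) /= s'E -scaleNr series_translate_socle; last first.
  by rewrite rpredD ?rpredZ ?subvsP.
by rewrite mulrN mulrA mulfV // mul1r /p horner_series_poly horner_line_poly subrr.
Qed.

End LinearEquivalence.

(** * From matching zero loci to multiplicativity *)

Section MultiplicativeEquivalence.
Variables (k : fieldType) (A B : comFalgType k) (nu : nat).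
Variables (M : {vspace A}) (s : A) (w : {scalar A}).
Variables (N : {vspace B}) (t : B) (v : {scalar B}).
Hypothesis gfA : gorenstein_functional M nu s w.
Hypothesis gfB : gorenstein_functional N nu t v.
Variable c : nat -> k.
Hypothesis c_neq0 : forall i, (0 < i <= nu)%N -> c i != 0.
Hypothesis kinf : infinite_set [set: k].
Variable L : 'Hom(subvs_of M, subvs_of N).
Hypothesis bijL : bijective L.
Hypothesis zeroL : forall x,
  series w c nu (vsval x) = 0 <-> series v c nu (vsval (L x)) = 0.

Lemma eqp_series_line x y :
  series_poly v c nu (line_poly (vsval (L x)) (vsval (L y))) %=
  series_poly w c nu (line_poly (vsval x) (vsval y)).
Proof.
have [L' LK L'K] := bijL.
have kL : lker L == 0%VS by apply/lker0P/bij_inj.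
have LV z : L (L^-1%VF z) = z by rewrite -{1}(L'K z) lker0_lfunK.
rewrite /eqp (dvdp_series_line gfA) //; last by move=> z /zeroL.
have := dvdp_series_line gfB c_neq0 kinf (L := L^-1%VF) _ (L x) (L y).
by rewrite !lker0_lfunK // => -> // z; rewrite -{1}(LV z) => /zeroL.
Qed.

(** The proportionality constant could depend on the line. All lines used pass through [s'], where
    the first series takes the nonzero value [c 1%N], and this fixes the constant. *)
Lemma series_equivalence : exists2 a, a != 0 &
  forall x, series v c nu (vsval (L x)) = a * series w c nu (vsval x).
Proof.
have gfs := gf_memS gfA; pose s' : subvs_of M := vsproj M s.
have s'E : vsval s' = s by rewrite vsprojK.
have ss : series w c nu s = c 1%N.
  have := series_translate_socle gfA c 1 (mem0v M).
  rewrite add0r scale1r mulr1 => ->.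
  rewrite /series big1 ?add0r // => [[[|i] /= _]] _.
    by rewrite expr0 (gf_w1 gfA) mulr0.
  by rewrite exprS mul0r linear0 mulr0.
have c1 : c 1%N != 0 by rewrite c_neq0 ?(gf_nu_gt0 gfA).
have scal y : exists2 a, a != 0 & series v c nu (vsval (L s')) = a * c 1%N /\
    series v c nu (vsval (L y)) = a * series w c nu (vsval y).
  (* This line meets [s'] at parameter 0 and [y] at parameter 1. *)
  have /eqpf_eq[a an0 E] := eqp_series_line s' (y - s').
  exists a => //; have E0 := congr1 (horner^~ 0) E; have E1 := congr1 (horner^~ 1) E.
  move: E0 E1; rewrite !hornerZ !horner_series_poly !horner_line_poly.
  by rewrite !scale0r !addr0 !scale1r !linearB /= !(addrC _ (_ - _)) !subrK s'E ss.
have [a an0 [Ea _]] := scal 0; exists a => // x; have [b _ [Eb ->]] := scal x.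
by have /(mulIf c1) -> : b * c 1%N = a * c 1%N by rewrite -Ea.
Qed.

(** On the line through 0 and [x] the two series are proportional polynomials in the parameter, [k]
    being infinite; the coefficient of degree [i] isolates the [i]-th power. *)
Lemma power_equivalence : exists2 a, a != 0 & forall i x, (0 < i <= nu)%N ->
  v (vsval (L x) ^+ i) = a * w (vsval x ^+ i).
Proof.
have [a an0 La] := series_equivalence; exists a => // i x /andP[i0 inu].
have ci : c i != 0 by rewrite c_neq0 ?i0.
apply: (mulfI ci); rewrite mulrCA -!(coef_series_polyX _ _ _ inu) -coefZ.
suff -> : series_poly v c nu ((vsval (L x))%:P * 'X) =
    a *: series_poly w c nu ((vsval x)%:P * 'X) by [].
apply/eqP; rewrite -subr_eq0; apply/eqP/infinite_field_poly_eq0 => // e.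
rewrite hornerD hornerN hornerZ !horner_series_poly !hornerM !hornerC !hornerX /=.
by rewrite !mulr_algr -!linearZ /= La subrr.
Qed.

Hypothesis fact_unit : forall i, (i <= nu)%N -> i`!%:R != 0 :> k.

Lemma multiplicative_equivalence x y : L (idealmul x y) = idealmul (L x) (L y).
Proof.
have idM := gf_ideal gfA; have idN := gf_ideal gfB.
have [a an0 La] := power_equivalence.
have polar2 x1 x2 : v (vsval (L x1) * vsval (L x2)) = a * w (vsval x1 * vsval x2).
  case: (ltnP 1 nu) => [lt1|le1]; last first.
    by rewrite (gf_mul2_eq0 gfA) ?(gf_mul2_eq0 gfB) ?subvsP // !linear0 mulr0.
  (* Polarization; the factor 2 is [2!], invertible as [nu] is at least 2 here. *)
  have sq (C : comNzRingType) (z1 z2 : C) :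
      (z1 * z2) *+ 2 = (z1 + z2) ^+ 2 - z1 ^+ 2 - z2 ^+ 2 by ring.
  apply: (mulfI (fact_unit lt1)); rewrite mulrCA !mulr_natl -!linearMn /=.
  rewrite !sq !linearB /= -!linearD /= !La //.
  by rewrite !mulrBr.
have polar3 x1 x2 x3 : v (vsval (L x1) * vsval (L x2) * vsval (L x3)) =
    a * w (vsval x1 * vsval x2 * vsval x3).
  case: (ltnP 2 nu) => [lt2|le2]; last first.
    by rewrite (gf_mul3_eq0 gfA) ?(gf_mul3_eq0 gfB) ?subvsP // !linear0 mulr0.
  (* Cubic polarization; the factor 6 is [3!], invertible as [nu] is at least 3 here. *)
  have cube (C : comNzRingType) (z1 z2 z3 : C) : (z1 * z2 * z3) *+ 6 =
      (z1 + z2 + z3) ^+ 3 - (z1 + z2) ^+ 3 - (z2 + z3) ^+ 3 - (z1 + z3) ^+ 3 +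
      z1 ^+ 3 + z2 ^+ 3 + z3 ^+ 3 by ring.
  apply: (mulfI (fact_unit lt2)); rewrite mulrCA !mulr_natl -!linearMn /=.
  rewrite !cube !(linearB, linearD) /= -!linearD /= !La //.
  by rewrite !(mulrDr, mulrN).
apply/val_inj; rewrite /= [RHS]vsval_idealmul //.
apply/eqP; rewrite -subr_eq0; apply/eqP/(gf_nondegenerate gfB) => b.
have [L' _ L'K] := bijL.
(* The test element [b] splits into a part in [N], which is [L z], and its residue times [1]. The
   first part is settled by [polar2] and [polar3], the second by degree 1 and [polar2]. *)
pose z := L' (vsproj N (b - v (b * t) *: 1)).
have -> : b = vsval (L z) + v (b * t) *: 1.
  by rewrite L'K vsprojK ?(gf_residue gfB) // subrK.
rewrite mulrDr linearD /= -scalerAr mulr1 linearZ /= mulrBl !linearB /=.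
rewrite polar2 polar3 vsval_idealmul // subrr add0r.
have := La 1%N (idealmul x y) (gf_nu_gt0 gfB); rewrite !expr1 => ->.
by rewrite polar2 vsval_idealmul // subrr mulr0.
Qed.

End MultiplicativeEquivalence.

(** * From an admissible projection to a functional *)

Section AdmissibleFunctional.
Variables (k : fieldType) (A : comFalgType k) (M : {vspace A}) (nu : nat).

(** The ideal generated by [M] and [b] is strictly larger than [M], hence contains [1]. *)
Lemma maximal_ideal_comaximal b : is_maximal_ideal M -> b \notin M ->
  exists2 n, n \in M & exists u, 1 = n + u * b.
Proof.
move=> [idM _ maxM] bM; pose I := (M + {:A} * <[b]>)%VS.
have MI : (M <= I)%VS by apply: addvSl.
have bI : b \in I.
  apply: (subvP (addvSr M _)).
  by have := memv_mul (memvf (1 : A)) (memv_line b); rewrite mul1r.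
have idI : is_ideal I.
  rewrite /is_ideal /I prodvDr; apply: addvS; first exact: idM.
  by rewrite prodvA prodvSl ?subvf.
have [EI|EI] := maxM I idI MI; first by rewrite -EI bI in bM.
have : 1 \in I by rewrite EI memvf.
case/memv_addP => n nM [_ /memv_cosetP[u _ ->] ->].
by exists n => //; exists u.
Qed.

Lemma admissible_functional (pi : 'End(A)) : gorenstein M ->
    (1 < \dim {: A})%N -> has_socle_degree M nu -> admissible_projection M pi ->
  exists s, exists2 w : {scalar A},
    gorenstein_functional M nu s w & forall x, pi x = w x *: s.
Proof.
move=> [[maxM _] dimS] dimA [_ nuM] [piK limpi pi1].
pose s := vpick (socle M).
have s_neq0 : s != 0 by rewrite vpick0 -dimv_eq0 dimS.
have socE : socle M = <[s]>%VS.
  apply/esym/eqP; rewrite eqEdim dimS dim_vline s_neq0 andbT -memvE.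
  exact: memv_pick.
pose w : {scalar A} := coord [tuple s] ord0 \o pi.
have piE x : pi x = w x *: s.
  have : pi x \in <<[tuple s]>>%VS by rewrite span_seq1 -socE -limpi memv_img ?memvf.
  by move/coord_span => {1}->; rewrite big_ord1.
have pi_soc x : x \in socle M -> pi x = x.
  by rewrite -limpi => /memv_imgP[y _ ->]; rewrite -comp_lfunE piK.
have idM : is_ideal M by case: maxM.
have Ms x : x \in M -> x * s = 0.
  by move=> xM; rewrite mulrC; apply: (socleP M s _); rewrite ?socE ?memv_line.
have ann_s b : b * s = 0 -> b \in M.
  move=> bs0; apply/negPn/negP => /(maximal_ideal_comaximal maxM)[n nM [u E]].
  by case/negP: s_neq0; rewrite -[s]mul1r E mulrDl Ms // -mulrA bs0 mulr0 addr0.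
have soc x : (forall y, y \in M -> x * y = 0) -> x = w x *: s.
  by move=> /(socleP M x) xS; rewrite -piE pi_soc.
(* [a * s] is in the socle, so it equals [w (a * s) *: s]; the difference therefore annihilates [s]
   and lies in [M]. *)
have residue a : a - w (a * s) *: 1 \in M.
  apply: ann_s; rewrite mulrBl -scalerAl mul1r -soc ?subrr // => y yM.
  by rewrite -mulrA [s * y]mulrC Ms ?mulr0.
have nilM : (M ^+ nu.+1)%VS = 0%VS.
  by apply/eqP/negPn/negP => /nuM; rewrite ltnn.
exists s, w => //; split=> //.
(* If [s] were outside [M], then [1 = n + u * s] would give [y = n * y] on [M]. As [n] is nilpotent,
   [M] would be 0 and, by [residue], [A] would have dimension at most 1. *)
- apply/negPn/negP => /(maximal_ideal_comaximal maxM)[n nM [u E]].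
  have M0 y : y \in M -> y = 0.
    move=> yM; have ny : y = n * y.
      by rewrite -[LHS]mul1r E mulrDl -mulrA [s * y]mulrC Ms // mulr0 addr0.
    have nj j : y = n ^+ j * y.
      by elim: j => [|j IHj]; rewrite ?mul1r // exprSr -mulrA -ny.
    have := mem_expvX nu.+1 nM; rewrite nilM memv0 => /eqP n0.
    by rewrite (nj nu.+1) n0 mul0r.
  suff : (\dim {:A} <= 1)%N by rewrite leqNgt dimA.
  apply: leq_trans (dimvS (_ : _ <= <[1 : A]>)%VS) _; last by rewrite dim_vline leq_b1.
  apply/subvP => x _; apply/vlineP; exists (w (x * s)).
  by apply/eqP; rewrite -subr_eq0; apply/eqP/M0.
- have : pi s = s by rewrite pi_soc // socE memv_line.
  rewrite piE => /eqP; rewrite -subr_eq0 -[X in _ - X]scale1r -scalerBl scaler_eq0.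
  by rewrite (negPf s_neq0) orbF subr_eq0 => /eqP.
- by apply/eqP; have /eqP := pi1; rewrite piE scaler_eq0 (negPf s_neq0) orbF.
Qed.

End AdmissibleFunctional.

(** * Multiplying the argument of the functional by a fixed element *)

Section Twist.
Variables (k : fieldType) (A : comFalgType k) (w : {scalar A}) (a : A).

Definition twist x : k := w (a * x).

Lemma twist_is_scalar : scalar twist.
Proof. by move=> c x y; rewrite /twist mulrDr -scalerAr linearP. Qed.

HB.instance Definition _ := GRing.isLinear.Build k A k *%R twist twist_is_scalar.

(** An element that is 1 modulo [M] acts as the identity on the socle, so the twist agrees with [w]
    there; [w a = 0] makes it vanish at [1]. *)
Lemma gorenstein_functional_twist (M : {vspace A}) nu s :
  gorenstein_functional M nu s w -> a - 1 \in M -> w a = 0 ->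
  gorenstein_functional M nu s twist.
Proof.
move=> gf aM wa0.
have annE x : (forall y, y \in M -> x * y = 0) -> twist x = w x.
  move=> xM; rewrite /twist; congr (w _); apply/eqP.
  by rewrite -subr_eq0 -{2}[x]mul1r -mulrBl mulrC xM.
have ann_s b y : y \in M -> b * s * y = 0.
  by move=> yM; rewrite -mulrA [s * y]mulrC (gf_mulMs gf) ?mulr0.
case: (gf) => idM nilM sM Ms soc ws w1 res; split => //.
- by move=> x xM; rewrite /= annE // -soc.
- by rewrite /= annE // => y yM; rewrite -[s]mul1r ann_s.
- by rewrite /= /twist mulr1.
- by move=> b; rewrite /= annE // => y yM; rewrite ann_s.
Qed.

End Twist.

(** * The hypersurface as a zero locus *)

Section Reflection.
Variables (k : fieldType) (A : comFalgType k) (M : {vspace A}) (nu : nat).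
Variables (s : A) (w : {scalar A}).
Hypothesis gf : gorenstein_functional M nu s w.

Definition exp_coef i : k := (i`!%:R)^-1.

(** Exponential coefficients with the linear sign reversed: on [x + e *: s] with [x] in [M] and
    [w x = 0], the series is [w (texp nu x) - e], the equation of the graph. *)
Definition graph_coef i : k := if i == 1%N then -1 else exp_coef i.

Lemma series_exp y : series w exp_coef nu y = w (texp nu y).
Proof.
rewrite /texp big_mkord linear_sum; apply: eq_bigr => i _; by rewrite linearZ.
Qed.

Lemma series_graph y : series w graph_coef nu y = w (texp nu y) - 2%:R * w y.
Proof.
rewrite -series_exp /series; case: nu (gf_nu_gt0 gf) => // n _.
rewrite !big_ord_recl /= /graph_coef /exp_coef /= invr1 !mul1r expr0 expr1.
rewrite (gf_w1 gf) !add0r; ring.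
Qed.

Lemma hypersurfaceP (pi : 'End(A)) (z : subvs_of M) :
  (forall x, pi x = w x *: s) ->
  hypersurface M nu pi z <-> series w graph_coef nu (vsval z) = 0.
Proof.
move=> piE; have ws := gf_ws gf.
have KP x : (x \in calK M pi) = (w x == 0) && (x \in M).
  by rewrite memv_cap memv_ker piE scaler_eq0 (negPf (gf_s_neq0 gf)) orbF.
split=> [[x] | z0].
  rewrite KP => /andP[/eqP wx xM] ->; rewrite /Ppi piE.
  rewrite (series_translate_socle gf) // series_graph wx /graph_coef /=; ring.
pose x := vsval z - w (vsval z) *: s.
have zE : vsval z = x + w (vsval z) *: s by rewrite subrK.
have xM : x \in M by rewrite rpredB ?rpredZ ?(gf_memS gf) ?subvsP.
have wx : w x = 0 by rewrite linearB linearZ /= ws mulr1 subrr.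
exists x; first by rewrite KP wx eqxx.
rewrite {1}zE /Ppi piE; congr (_ + _ *: _); move: z0.
rewrite zE (series_translate_socle gf) // series_graph wx /graph_coef /= -zE.
by rewrite mulr0 subr0 mulN1r => /eqP; rewrite subr_eq0 => /eqP.
Qed.

(** Subtracting [2 * w u] times [s] negates the socle coordinate because [w s = 1]; this restores
    the sign reversed in [graph_coef]. *)
Lemma hypersurface_reflection (pi : 'End(A)) :
  (forall x, pi x = w x *: s) ->
  exists2 R : 'End(subvs_of M), involutive R &
    forall u, hypersurface M nu pi (R u) <-> w (texp nu (vsval u)) = 0.
Proof.
move=> piE; pose s' := vsproj M s.
have s'E : vsval s' = s by rewrite vsprojK ?(gf_memS gf).
pose r (u : subvs_of M) : subvs_of M := u - (2%:R * w (vsval u)) *: s'.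
have linr : linear r.
  move=> c x y; rewrite /r !linearP /= mulrDr scalerDl mulrCA -!scalerA.
  by rewrite scalerBr opprD addrACA !scalerA.
pose lr := GRing.isLinear.Build _ _ _ _ r linr.
pose R := linfun (HB.pack_for {linear subvs_of M -> subvs_of M} r lr).
have RE u : vsval (R u) = vsval u - (2%:R * w (vsval u)) *: s.
  by rewrite lfunE /= s'E.
have wR u : w (vsval (R u)) = - w (vsval u).
  by rewrite RE linearB linearZ /= (gf_ws gf); ring.
exists R => u.
  apply/val_inj; rewrite /= RE wR RE mulrN scaleNr opprK subrK //.
rewrite (hypersurfaceP _ piE) RE -scaleNr (series_translate_socle gf) ?subvsP //.
by rewrite series_graph /graph_coef /= mulN1r opprK subrK.
Qed.

End Reflection.

(** * The maximal ideal as the set of nilpotents *)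

Section Nilpotents.
Variables (k : fieldType) (A : comFalgType k) (M : {vspace A}) (nu : nat).
Variables (s : A) (w : {scalar A}).
Hypothesis gf : gorenstein_functional M nu s w.

(** This description is transported by any algebra isomorphism. For the converse, [x] acts on [s] by
    its residue, and nilpotency forces that scalar to be 0. *)
Lemma mem_maximal_idealP x : reflect (x ^+ nu.+1 = 0) (x \in M).
Proof.
apply: (iffP idP) => [xM | xn0].
  by have := mem_expvX nu.+1 xM; rewrite (gf_nil gf) memv0 => /eqP.
have powE j : x ^+ j * s = w (x * s) ^+ j *: s.
  elim: j => [|j IHj]; first by rewrite mul1r scale1r.
  rewrite exprS -mulrA IHj -scalerAr [X in _ *: X = _](gf_mul_s gf).
  by rewrite scalerA -exprSr.
have := powE nu.+1; rewrite xn0 mul0r => /esym/eqP.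
rewrite scaler_eq0 (negPf (gf_s_neq0 gf)) orbF expf_eq0 => /eqP w0.
by have := gf_residue gf x; rewrite w0 scale0r subr0.
Qed.

End Nilpotents.

(** * Isomorphisms of maximal ideals and of algebras *)

Section IsomorphismExtension.
Variables (k : fieldType) (A B : comFalgType k) (nu : nat).
Variables (M : {vspace A}) (s : A) (w : {scalar A}).
Variables (N : {vspace B}) (t : B) (v : {scalar B}).
Hypothesis gfA : gorenstein_functional M nu s w.
Hypothesis gfB : gorenstein_functional N nu t v.

(** [A] is the direct sum of the scalars and [M]; the extension is the identity on scalars and [L]
    on [M]. *)
Lemma alg_isomorphic_of_ideal_iso (L : 'Hom(subvs_of M, subvs_of N)) :
  bijective L -> (forall x y, L (idealmul x y) = idealmul (L x) (L y)) ->
  alg_isomorphic A B.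
Proof.
move=> [L' LK L'K] multL.
have idM := gf_ideal gfA; have idN := gf_ideal gfB.
(* The residue map modulo [M]; it is multiplicative because each element acts on [s] by its
   residue. *)
pose chi a := w (a * s).
pose rho a : subvs_of M := vsproj M (a - chi a *: 1).
have rhoE a : vsval (rho a) = a - chi a *: 1 by rewrite vsprojK ?(gf_residue gfA).
pose f a : B := chi a *: 1 + vsval (L (rho a)).
have chi_linear c x y : chi (c *: x + y) = c * chi x + chi y.
  by rewrite /chi mulrDl -scalerAl linearP.
have linf : linear f.
  move=> c x y; rewrite /f chi_linear.
  have -> : rho (c *: x + y) = c *: rho x + rho y.
    apply/val_inj; rewrite /= !rhoE chi_linear.
    by rewrite scalerBr scalerDl scalerA opprD addrACA.
  rewrite [L _]linearP [vsval (_ + _)]linearP /=.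
  by rewrite scalerDl scalerDr scalerA addrACA.
have chi1 : chi 1 = 1 by rewrite /chi mul1r (gf_ws gfA).
have chiM x y : chi (x * y) = chi x * chi y.
  by rewrite /chi -mulrA [in LHS](gf_mul_s gfA y) -scalerAr linearZ /= mulrC.
have algM (c d : k) (C : comFalgType k) : (c * d)%:A = c%:A * d%:A :> C.
  by rewrite mulr_algl scalerA.
have rho1 : rho 1 = 0 by apply/val_inj; rewrite /= rhoE chi1 scale1r subrr.
have multf : monoid_morphism f.
  split; first by rewrite /f rho1 linear0 chi1 scale1r addr0.
  move=> x y; rewrite /f chiM.
  have -> : rho (x * y) = chi x *: rho y + chi y *: rho x + idealmul (rho x) (rho y).
    apply/val_inj; rewrite /= vsval_idealmul // !rhoE chiM.
    by rewrite -!(mulr_algl _ (_ - _)) algM; ring.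
  rewrite !linearD !linearZ /= multL vsval_idealmul // algM.
  by rewrite -!(mulr_algl _ (vsval _)); ring.
pose F : {lrmorphism A -> B} := HB.pack f
  (GRing.isLinear.Build _ _ _ _ f linf) (GRing.isMonoidMorphism.Build _ _ f multf).
exists F.
pose g b : A := v (b * t) *: 1 + vsval (L' (vsproj N (b - v (b * t) *: 1))).
exists g => [a | b] /=.
  have vf : v (f a * t) = chi a.
    rewrite /f mulrDl -scalerAl mul1r (gf_mulMs gfB) ?subvsP // addr0.
    by rewrite linearZ /= (gf_ws gfB) mulr1.
  have fr : f a - chi a *: 1 = vsval (L (rho a)) by rewrite /f addrAC subrr add0r.
  by rewrite /g vf fr vsvalK LK rhoE addrC subrK.
have chig : chi (g b) = v (b * t).
  rewrite /chi /g mulrDl -scalerAl mul1r (gf_mulMs gfA) ?subvsP // addr0.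
  by rewrite linearZ /= (gf_ws gfA) mulr1.
have -> : f (g b) = v (b * t) *: 1 + vsval (L (rho (g b))) by rewrite /f chig.
have -> : rho (g b) = L' (vsproj N (b - v (b * t) *: 1)).
  by apply/val_inj; rewrite /= rhoE chig /g addrAC subrr add0r.
by rewrite L'K vsprojK ?(gf_residue gfB) // addrC subrK.
Qed.

Hypothesis fact_unit : forall i, (i <= nu)%N -> i`!%:R != 0 :> k.

Lemma lrmorphism_texp (f : {lrmorphism A -> B}) x : f (texp nu x) = texp nu (f x).
Proof. by rewrite linear_sum; apply: eq_bigr => i _; rewrite linearZ rmorphXn. Qed.

(** The functional [v \o f] is [w (a * _)] for some [a]. Its residue [c] is nonzero, so [a] is [c]
    times some [texp nu x], and [texpD] turns that factor into a translation by [x]. *)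
Lemma functional_pullback (f : {lrmorphism A -> B}) : bijective f ->
  exists2 x, x \in M & exists2 c, c != 0 &
    forall y, y \in M -> v (texp nu (f y)) = c * w (texp nu (y + x)).
Proof.
move=> [g fK gK].
have fM y : (y \in M) = (f y \in N).
  apply/(sameP (mem_maximal_idealP gfA y))/(iffP (mem_maximal_idealP gfB _)).
    by rewrite -rmorphXn -[RHS](rmorph0 f) => /(can_inj fK).
  by move=> yn; rewrite -rmorphXn yn rmorph0.
have [a aE] := gf_representable gfA (v \o f).
pose c := w (a * s).
have vfs : v (f s) = c by rewrite /c -aE.
have c0 : c != 0.
  (* [f s] lies in the socle of [B], so it equals [v (f s) *: t]; with [c = 0] this would give
     [f s = 0]. *)
  apply/eqP => c0; have /negP[] := gf_s_neq0 gfA.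
  rewrite -(can_eq fK) rmorph0 (gf_socle gfB (x := f s)) ?vfs ?c0 ?scale0r //.
  move=> y yN; rewrite -[y]gK -rmorphM mulrC (gf_mulMs gfA) ?rmorph0 //.
  by rewrite fM gK.
have /(texp_surj (gf_ideal gfA) (gf_nil gfA) fact_unit (gf_nu_gt0 gfA))[x xM xE] :
    c^-1 *: a - 1 \in M.
  have -> : c^-1 *: a - 1 = c^-1 *: (a - c *: 1).
    by rewrite scalerBr scalerA mulVf // scale1r.
  by rewrite rpredZ ?(gf_residue gfA).
exists x => //; exists c => // y yM.
rewrite -lrmorphism_texp [LHS]aE (texpD (gf_ideal gfA) (gf_nil gfA)) // xE.
by rewrite -scalerAr linearZ /= mulrA mulfV // mul1r mulrC.
Qed.

End IsomorphismExtension.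

Lemma fact_neq0_of_pchar (k : fieldType) nu :
  has_pchar0 k \/ (exists2 p, p \in [pchar k] & (nu < p)%N) ->
  forall i, (i <= nu)%N -> i`!%:R != 0 :> k.
Proof.
case=> [/pcharf0P k0 i _ | [p kp nup] i inu]; first by rewrite k0 -lt0n fact_gt0.
elim: i inu => [|i IHi] inu; first by rewrite oner_eq0.
rewrite factS natrM mulf_neq0 ?IHi 1?ltnW // -(dvdn_pcharf kp).
by rewrite gtnNdvd // (leq_trans _ nup).
Qed.

Lemma image_eqP (T U : Type) (F : T -> U) (S : set T) (S' : set U) : bijective F ->
  F @` S = S' <-> forall x, S x <-> S' (F x).
Proof.
move=> [G FK GK]; split=> [<- x | SS'].
  split=> [Sx | [y Sy /(can_inj FK) <-]] //; by exists x.
apply/seteqP; split=> [_ [x Sx <-] | y S'y]; first exact/SS'.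
by exists (G y); rewrite ?GK // SS' GK.
Qed.

(** * Affine equivalence of hypersurfaces *)

Section AffineEquivalence.
Variables (k : fieldType) (A B : comFalgType k) (nu : nat).
Variables (M : {vspace A}) (s : A) (w : {scalar A}) (piA : 'End(A)).
Variables (N : {vspace B}) (t : B) (v : {scalar B}) (piB : 'End(B)).
Hypothesis gfA : gorenstein_functional M nu s w.
Hypothesis gfB : gorenstein_functional N nu t v.
Hypothesis piAE : forall x, piA x = w x *: s.
Hypothesis piBE : forall x, piB x = v x *: t.
Hypothesis fact_unit : forall i, (i <= nu)%N -> i`!%:R != 0 :> k.

Lemma affinely_equivalent_of_iso : alg_isomorphic A B ->
  affinely_equivalent (hypersurface M nu piA) (hypersurface N nu piB).
Proof.
case=> f bijf; have [g fK gK] := bijf.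
have [RA RAK SA] := hypersurface_reflection gfA piAE.
have [RB RBK SB] := hypersurface_reflection gfB piBE.
have [x xM [c c0 pull]] := functional_pullback gfA gfB fact_unit bijf.
have fM y : y \in M -> f y \in N.
  move/(mem_maximal_idealP gfA) => yn; apply/(mem_maximal_idealP gfB).
  by rewrite -rmorphXn yn rmorph0.
have gN y : y \in N -> g y \in M.
  move/(mem_maximal_idealP gfB) => yn; apply/(mem_maximal_idealP gfA).
  by apply: (can_inj fK); rewrite rmorphXn /= gK yn rmorph0.
pose phi (u : subvs_of M) : subvs_of N := vsproj N (f (vsval u)).
have phiE u : vsval (phi u) = f (vsval u) by rewrite vsprojK ?fM ?subvsP.
have linphi : linear phi.
  by move=> d u1 u2; apply/val_inj; rewrite /= !phiE !linearP.
pose Phi := linfun (HB.pack_for {linear subvs_of M -> subvs_of N} phi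
  (GRing.isLinear.Build _ _ _ _ phi linphi)).
have PhiE u : Phi u = phi u by rewrite lfunE.
pose psi (u : subvs_of N) : subvs_of M := vsproj M (g (vsval u)).
have phiK : cancel phi psi.
  by move=> u; apply/val_inj; rewrite /= /psi phiE fK vsvalK.
have psiK : cancel psi phi.
  by move=> u; apply/val_inj; rewrite /= phiE /psi vsprojK ?gN ?subvsP // gK.
pose x' := vsproj M x; have x'E : vsval x' = x by rewrite vsprojK.
(* Reflect to the zero locus of [w] after the exponential, shift by [- x'] to offset the translation
   in [pull], apply the isomorphism, and reflect back. *)
pose F u := RB (phi (RA u - x')).
have bijF : bijective F.
  exists (fun z => RA (psi (RB z) + x')) => z; rewrite /F.
    by rewrite RBK phiK subrK RAK.
  by rewrite RAK addrK psiK RBK.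
exists F; split => //.
  exists (RB \o Phi \o RA)%VF, (- RB (phi x')) => u.
  by rewrite !comp_lfunE PhiE /F -!PhiE !linearB.
apply/(image_eqP _ _ bijF) => u; rewrite -{1}[u]RAK SA /F SB phiE pull ?subvsP //.
rewrite linearB /= x'E subrK; split=> [->|/eqP]; first by rewrite mulr0.
by rewrite mulf_eq0 (negPf c0) => /eqP.
Qed.

Hypothesis kinf : infinite_set [set: k].

Let exp_coef_neq0 i : (0 < i <= nu)%N -> exp_coef k i != 0.
Proof. by case/andP => _ inu; rewrite invr_neq0 ?fact_unit. Qed.

(** The series with [graph_coef] is used so that the conclusion concerns [F] itself, not its
    conjugate by the reflections. *)
Lemma linear_equivalence_multiplicative (F : 'Hom(subvs_of M, subvs_of N)) :
  bijective F -> F @` hypersurface M nu piA = hypersurface N nu piB ->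
  forall x y, F (idealmul x y) = idealmul (F x) (F y).
Proof.
move=> bijF /(image_eqP _ _ bijF) SF.
apply: (multiplicative_equivalence gfA gfB (c := @graph_coef k)) => // [i i_nu | x].
  by rewrite /graph_coef; case: ifP => _; rewrite ?oppr_eq0 ?oner_eq0 ?exp_coef_neq0.
rewrite -(hypersurfaceP gfA _ piAE) -(hypersurfaceP gfB _ piBE); exact: SF.
Qed.

(** Conjugation by the reflections gives an affine map [L' u + b'] matching the zero loci of the
    exponential series. Twisting [v] by [texp nu b'] absorbs the translation and leaves the linear
    map [L']. *)
Lemma iso_of_affinely_equivalent :
  affinely_equivalent (hypersurface M nu piA) (hypersurface N nu piB) ->
  alg_isomorphic A B.
Proof.
case=> F [bijF [L [b FE]] /(image_eqP _ _ bijF) SF].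
have [RA RAK SA] := hypersurface_reflection gfA piAE.
have [RB RBK SB] := hypersurface_reflection gfB piBE.
pose L' := (RB \o L \o RA)%VF; pose b' := RB b.
have L'E u : L' u + b' = RB (F (RA u)).
  by rewrite !comp_lfunE FE /b' -linearD.
have ZL' u : w (texp nu (vsval u)) = 0 <-> v (texp nu (vsval (L' u + b'))) = 0.
  by rewrite -SA SF L'E -SB RBK.
have bijL' : bijective L'.
  have [G FK GK] := bijF.
  exists (fun z => RA (G (RB (z + b')))) => z.
    by rewrite L'E RBK FK RAK.
  by apply: (addIr b'); rewrite L'E RAK GK RBK.
(* The origin lies in the first zero locus, so its image [b'] lies in the second; this is the
   normalization required of the twist. *)
have b'0 : v (texp nu (vsval b')) = 0.
  have /(ZL' 0) : w (texp nu (vsval (0 : subvs_of M))) = 0.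
    by rewrite linear0 texp0 (gf_w1 gfA).
  by rewrite linear0 add0r.
have idN := gf_ideal gfB; have nilN := gf_nil gfB; have nu0 := gf_nu_gt0 gfB.
have gfB' := gorenstein_functional_twist gfB
  (texp_sub1 idN nu0 (subvsP b')) b'0.
apply: (alg_isomorphic_of_ideal_iso gfA gfB' bijL').
apply: (multiplicative_equivalence gfA gfB' (c := @exp_coef k)) => // u.
rewrite !series_exp ZL' linearD /= addrC (texpD idN nilN) ?subvsP //.
Qed.

End AffineEquivalence.

Theorem theorem2p1 (k : fieldType) (A B : comFalgType k) (nu : nat)
    (mA : {vspace A}) (mB : {vspace B}) (piA : 'End(A)) (piB : 'End(B))
    (infinite_k : infinite_set [set: k])
    (gorA : gorenstein mA) (gorB : gorenstein mB)
    (dimA : (1 < \dim {: A})%N) (dimB : (1 < \dim {: B})%N)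
    (nuA : has_socle_degree mA nu) (nuB : has_socle_degree mB nu)
    (char_k : has_pchar0 k \/ exists2 p, p \in [pchar k] & (nu < p)%N)
    (admA : admissible_projection mA piA)
    (admB : admissible_projection mB piB) :
  (alg_isomorphic A B <->
     affinely_equivalent (hypersurface mA nu piA) (hypersurface mB nu piB)) /\
  (forall F : 'Hom(subvs_of mA, subvs_of mB), bijective F ->
     F @` hypersurface mA nu piA = hypersurface mB nu piB ->
     forall x y : subvs_of mA, F (idealmul x y) = idealmul (F x) (F y)).
Proof.
have fact_unit := fact_neq0_of_pchar char_k.
have [s [w gfA piAE]] := admissible_functional gorA dimA nuA admA.
have [t [v gfB piBE]] := admissible_functional gorB dimB nuB admB.
split; first split.
- exact: affinely_equivalent_of_iso gfA gfB piAE piBE fact_unit.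
- exact: iso_of_affinely_equivalent gfA gfB piAE piBE fact_unit infinite_k.
- exact: linear_equivalence_multiplicative gfA gfB piAE piBE fact_unit infinite_k.
Qed.
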